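(* Let $(D_n)_{n\ge1}$ be connected regular domains of the family $\mathcal D$ such that $x_0\in D_1$, $D_n\Subset D_{n+1}$ for all $n$, and $D=\bigcup_{n\ge1}D_n$, and suppose that for every $n$ the relative kernel $K_{D_n}$ has a jointly continuous version on $D_n\times\partial D_n$ (this version is used). Let $D^K$ be a compact metrizable compactification of $D$, let $\xi\in D^K\setminus D$, and let $h_\xi\in\mathcal E(D)$. Put $d\nu_n^\xi(y)=h_\xi(y)\,d\omega_{x_0}^{D_n}(y)$ on $\partial D_n$, regarded as a measure on $D^K$ through $\partial D_n\subset D\subset D^K$, and assume that $$\liminf_{n\to\infty}\nu_n^\xi(V)>0\quad\text{for every open neighborhood }V\text{ of }\xi\text{ in }D^K.$$ Then there exist $n_0\ge1$ and points $\xi_n\in\partial D_n$, $n\ge n_0$, such that $$\xi_n\longrightarrow\xi\ \text{ in }D^K,\qquad K_{D_n}(\cdot,\xi_n)\longrightarrow h_\xi\ \text{ locally uniformly in }D.$$ If, moreover, for every $n$ and every $y\in\partial D_n$ the function $K_{D_n}(\cdot,y)$ is a minimal positive harmonic function on $D_n$, i.e. $\partial_{\mathrm m}D_n=\partial D_n$, then $\xi_n\in\partial_{\mathrm m}D_n=\partial D_n$.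
   Context: Let $X$ be a metric space. A domain is a nonempty connected open set; $V\Subset U$ means that $\overline V$ is compact and contained in $U$. Measures are positive Borel measures (completed when integrable functions are considered). A harmonic measure on a domain $U$ with $\partial U\ne\varnothing$ is a family $\{\omega_x^U:x\in U\}$ of measures on $\partial U$ with $\omega_x^U(\partial U)=1$ and $\omega_x^U\ll\omega_y^U$ for all $x,y\in U$; write $\omega_x^U(f)=\int_{\partial U}f\,d\omega_x^U$. It is continuous if $x\mapsto\omega_x^U(f)$ is continuous on $U$ for every $f\in\bigcap_{x\in U}L^1(\partial U,\omega_x^U)$, and Radon if every $\omega_x^U$ is Radon. The domain $U$ is regular if for every $\zeta\in\partial U$ and every bounded Borel $f$ on $\partial U$ continuous at $\zeta$ one has $\omega_x^U(f)\to f(\zeta)$ as $U\ni x\to\zeta$. Standing framework: $\mathcal D$ is a family of domains of $X$, each with nonempty boundary and equipped with a continuous Radon harmonic measure, such that (i) every $U\in\mathcal D$ is the union of an increasing sequence of regular domains of $\mathcal D$ whose closures are compact and contained in $U$; (ii) for $V\Subset U$ in $\mathcal D$ with $V$ regular, $\omega_x^U(f)=\int_{\partial V}\omega_y^U(f)\,d\omega_x^V(y)$ for all $x\in V$ and all bounded Borel $f$ on $\partial U$. $D\subseteq X$ is a domain and $x_0\in D$ is fixed. A function $u:W\to\mathbb R$ on an open set $W$ is harmonic if it is continuous and $u(x)=\int_{\partial V}u\,d\omega_x^V$ for every regular $V\in\mathcal D$ with $V\Subset W$ and every $x\in V$. A (strictly) positive harmonic function $h$ on a domain is minimal if every harmonic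 $v$ with $0\le v\le h$ equals $ch$ for some $c\in[0,1]$. $\mathcal H_1(D)$ is the set of strictly positive harmonic functions $h$ on $D$ with $h(x_0)=1$, with the topology of locally uniform convergence (uniform convergence on compact subsets), and $\mathcal E(D)$ is its set of extreme points, which are exactly the minimal positive harmonic functions $h$ with $h(x_0)=1$. For regular $U\in\mathcal D$ with $U\Subset D$, $x_0\in U$, the relative kernel is $K_U(x,y)=\frac{d\omega_x^U}{d\omega_{x_0}^U}(y)$, $x\in U$, $y\in\partial U$; $\partial_{\mathrm m}U$ is the set of $y\in\partial U$ for which $K_U(\cdot,y)$ is a minimal positive harmonic function on $U$. A compactification of $D$ is a compact Hausdorff space containing $D$ (with its topology) as a dense subspace. *)

(* Defs.v *)
From HB Require Import structures.
From mathcomp Require Import all_boot all_order all_algebra.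
From mathcomp Require Import all_classical all_reals all_analysis.

Set Implicit Arguments.
Unset Strict Implicit.
Unset Printing Implicit Defensive.

Import Order.TTheory GRing.Theory Num.Theory.
Import numFieldNormedType.Exports.

Local Open Scope classical_set_scope.
Local Open Scope ring_scope.

(* A metric space together with an arbitrary point: the library attaches
   sigma-algebras to pointed types only.  The point is never used. *)
#[short(type="pmetricType")]
HB.structure Definition PointedMetric (R : numDomainType) :=
  {T of Pointed T & Metric R T}.

Definition borel (T : ptopologicalType) := g_sigma_algebraType (@open T).

HB.instance Definition _ (T : ptopologicalType) := Measurable.on (borel T).

Definition boundary (T : topologicalType) (U : set T) : set T :=
  closure U `\` interior U.

Definition domain (T : topologicalType) (U : set T) : Prop :=
  [/\ U !=set0, open U & connected U].

(* V \Subset U *)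
Definition compactly_contained (T : topologicalType) (V U : set T) : Prop :=
  compact (closure V) /\ closure V `<=` U.

(* Local finiteness is automatic for probabilities. *)
Definition radon (R : realType) (T : ptopologicalType)
    (mu : probability (borel T) R) : Prop :=
  forall B : set (borel T), measurable B ->
    mu B = ereal_sup [set mu C | C in [set C : set T | compact C /\ C `<=` B]].

(* f belongs to L^1(A, mu) for the completion of mu: f need only agree with an
   integrable Borel function outside a mu-negligible set.  The library's
   integral of such an f is its integral for the completed measure. *)
Definition completed_L1 (R : realType) (T : ptopologicalType)
    (mu : probability (borel T) R) (A : set T) (f : T -> R) : Prop :=
  exists2 g : borel T -> R, mu.-integrable A (EFin \o g)
                          & {ae mu, forall y, A y -> f y = g y}.

Section HarmonicMeasure.
Context (R : realType) (X : pmetricType R).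

(* [omega U x] is the harmonic measure of U at x.  A measure on the closed set
   [boundary U] is represented by a Borel measure on X carried by it; values of
   [omega U x] for U outside the family, or for x outside U, are irrelevant. *)
Variable omega : set X -> X -> probability (borel X) R.

Definition hint (U : set X) (x : X) (f : X -> R) : R :=
  \int[omega U x]_(y in boundary U) (f y).

Definition harmonic_measure (U : set X) : Prop :=
  (forall x, U x -> omega U x (boundary U) = 1%E) /\
  (forall x y, U x -> U y -> omega U x `<< omega U y).

Definition continuous_hm (U : set X) : Prop :=
  forall f : X -> R,
    (forall x, U x -> completed_L1 (omega U x) (boundary U) f) ->
    {within U, continuous (fun x => hint U x f)}.

Definition radon_hm (U : set X) : Prop := forall x, U x -> radon (omega U x).

Definition bounded_borel (A : set X) (f : X -> R) : Prop :=
  measurable_fun (A : set (borel X)) (f : borel X -> R) /\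
  [bounded f y | y in A].

Definition regular (U : set X) : Prop :=
  forall (zeta : X) (f : X -> R), boundary U zeta ->
    bounded_borel (boundary U) f ->
    f y @[y --> within (boundary U) (nbhs zeta)] --> f zeta ->
    hint U x f @[x --> within U (nbhs zeta)] --> f zeta.

Variable dom : set (set X).

Record framework : Prop := Framework {
  fw_domain : forall U, dom U -> domain U ;
  fw_boundary : forall U, dom U -> boundary U !=set0 ;
  fw_hm : forall U, dom U -> harmonic_measure U ;
  fw_continuous : forall U, dom U -> continuous_hm U ;
  fw_radon : forall U, dom U -> radon_hm U ;
  fw_exhaustion : forall U, dom U -> exists V : nat -> set X,
    [/\ forall n, [/\ dom (V n), regular (V n) & compactly_contained (V n) U],
        forall n, V n `<=` V n.+1
      & U = \bigcup_n V n] ;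
  fw_tower : forall V U, dom V -> dom U -> compactly_contained V U ->
    regular V -> forall (x : X) (f : X -> R), V x ->
    bounded_borel (boundary U) f ->
    hint U x f = hint V x (fun y => hint U y f)
}.

(* Functions on W are represented by functions on X, considered only on W. *)
Definition harmonic (W : set X) (u : X -> R) : Prop :=
  {within W, continuous u} /\
  forall V x, dom V -> regular V -> compactly_contained V W -> V x ->
    u x = hint V x u.

Definition minimal (W : set X) (h : X -> R) : Prop :=
  [/\ harmonic W h,
      forall x, W x -> 0 < h x
    & forall v, harmonic W v -> (forall x, W x -> 0 <= v x <= h x) ->
      exists2 c : R, 0 <= c <= 1 & forall x, W x -> v x = c * h x].

(* H_1(D) *)
Definition positive_harmonic1 (D : set X) (x0 : X) (h : X -> R) : Prop :=
  [/\ harmonic D h, forall x, D x -> 0 < h x & h x0 = 1].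

(* E(D), the extreme points of H_1(D) *)
Definition extreme_harmonic (D : set X) (x0 : X) (h : X -> R) : Prop :=
  positive_harmonic1 D x0 h /\
  forall (h1 h2 : X -> R) (t : R),
    positive_harmonic1 D x0 h1 -> positive_harmonic1 D x0 h2 -> 0 < t < 1 ->
    (forall x, D x -> h x = t * h1 x + (1 - t) * h2 x) ->
    forall x, D x -> h1 x = h x /\ h2 x = h x.

(* K is a version of the relative kernel
   K_U(x, y) = (d omega_x^U / d omega_x0^U)(y), x in U, y in boundary U. *)
Definition kernel_version (U : set X) (x0 : X) (K : X -> X -> R) : Prop :=
  forall x, U x ->
    {ae omega U x0, forall y, boundary U y ->
      (K x y)%:E =
      Radon_Nikodym (charge_of_finite_measure (omega U x)) (omega U x0) y}.

Definition jointly_continuous (U : set X) (K : X -> X -> R) : Prop :=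
  {within U `*` boundary U, continuous (fun p : X * X => K p.1 p.2)}.

Definition minimal_boundary (U : set X) (K : X -> X -> R) : set X :=
  [set y | boundary U y /\ minimal U (fun x => K x y)].

(* The measure h d(omega_x0^U), transported by i : X -> Y. *)
Definition boundary_mass (U : set X) (x0 : X) (h : X -> R)
    (Y : Type) (i : X -> Y) (V : set Y) : \bar R :=
  (\int[omega U x0]_(y in boundary U `&` i @^-1` V) (h y)%:E)%E.

End HarmonicMeasure.

(* Y, with i restricted to D as the inclusion, is a compactification of D; the
   fourth clause says that i is a homeomorphism from D onto its image. *)
Definition compactification (X Y : topologicalType) (D : set X) (i : X -> Y)
    : Prop :=
  [/\ compact [set: Y], hausdorff_space Y, set_inj D i,
      forall A : set X, A `<=` D ->
        ((exists2 O : set X, open O & A = D `&` O) <->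
         (exists2 V : set Y, open V & A = D `&` i @^-1` V))
    & dense (i @` D)].

(* Main.v *)
Require Import Defs.
From mathcomp Require Import all_boot all_order all_algebra.
From mathcomp Require Import all_classical all_reals all_analysis.
From mathcomp Require Import measurable_realfun lra ring.

Set Implicit Arguments.
Unset Strict Implicit.
Unset Printing Implicit Defensive.

Import Order.TTheory GRing.Theory Num.Theory.
Import numFieldNormedType.Exports.

Local Open Scope classical_set_scope.
Local Open Scope ring_scope.

(** Write [mu_n] for the probability [h d omega_x0] on the boundary of [Dn n].
    The idea is that, [h] being extreme, the kernels [K n x y] concentrate at
    [h x] in [mu_n]-measure as [n] grows, uniformly for [x] in a compact set.
    Since [mu_n] eventually gives every neighbourhood of [xi] a mass bounded
    away from zero, a point [y] at which the kernel is close to [h] can be found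
    in any given neighbourhood of [xi]; a diagonal choice over shrinking
    neighbourhoods and growing compacts then yields the sequence.

    Concentration is proved as follows.  Let [f n] be a Borel function on the
    boundary of [Dn n] with [0 <= f n <= h], and let [v n x] be its integral
    for the harmonic measure at [x].  By the tower property, [v n] is on [Dn m],
    for [m < n], the integral against the jointly continuous kernel [K m] of a
    function of mass [v n x0 <= 1]; hence the sequence [v] is equicontinuous at
    each point of [D] ([hint_kernel_dist], [exhaustion_oscillation]).  Along an
    ultrafilter it therefore converges locally uniformly, to a harmonic function
    [u] with [0 <= u <= h] ([ultralimit_harmonic]), and extremality forces
    [u = u x0 * h] ([ultralimit_extreme]).  As this holds for every ultrafilter,
    [v n x - h x * v n x0] tends to [0] ([defect_cvg]).  For [f n] equal to [h]
    on the set where [K n x > h x] and to zero elsewhere, this says that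
    [K n x] tends to [h x] in [L^1 (mu_n)] ([kernel_mean_dist]).

    To pass from single points [x] to compact sets, the functions [K n ^~ y]
    must be equicontinuous as well, uniformly in [y] ([kernel_dist]).  This
    follows from the same estimate for [v], because [K n x y] is the limit of
    the quotients of the harmonic measures at [x] and [x0] of small
    neighbourhoods of [y] ([kernel_near_ratio]); regularity ensures that these
    neighbourhoods have positive measure ([hint_indic_gt0]). *)

(** * Borel sets, boundaries and jointly continuous kernels *)

Lemma open_borel (T : ptopologicalType) (O : set T) :
  open O -> measurable (O : set (borel T)).
Proof. by move=> oO; apply: sub_sigma_algebra. Qed.

Lemma closed_borel (T : ptopologicalType) (A : set T) :
  closed A -> measurable (A : set (borel T)).
Proof.
move=> cA; rewrite -[A]setCK; apply: (@measurableC _ (borel T)).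
by apply: open_borel; rewrite openC.
Qed.

Lemma within_continuous_borel (R : realType) (T : ptopologicalType) (A : set T)
    (f : T -> R) : {within A, continuous f} ->
  measurable_fun (A : set (borel T)) (f : borel T -> R).
Proof.
move=> /continuousP cf mA.
apply: (measurability _ (RGenOInfty.measurableE R)) => //.
move=> _ [_ [x ->] <-] /=.
have /open_subspaceP[V oV VE] : open ((f : subspace A -> R) @^-1` `]x, +oo[).
  by apply: cf; exact: interval_open.
rewrite setIC -VE; apply: (@measurableI _ (borel T)) => //.
exact: open_borel.
Qed.

Lemma within_compact_bounded (R : realType) (T : topologicalType) (A : set T)
    (f : T -> R) : compact A -> {within A, continuous f} ->
  [bounded f y | y in A].
Proof.
move=> cA cf; have := compact_bounded (continuous_compact cf cA).
rewrite /bounded_set /bounded_near => -[M [Mr H]]; exists M; split => //.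
move=> x Mx y Ay /=.
by apply: (H _ Mx); exists y.
Qed.

Lemma closed_boundary (T : topologicalType) (U : set T) :
  closed (boundary U).
Proof.
rewrite /boundary setDE; apply: closedI; first exact: closed_closure.
by apply: open_closedC; exact: open_interior.
Qed.

Lemma boundary_sub_closure (T : topologicalType) (U : set T) :
  boundary U `<=` closure U.
Proof. by move=> x []. Qed.

Lemma compact_boundary (T : topologicalType) (U V : set T) :
  compactly_contained U V -> compact (boundary U).
Proof.
move=> [cU _]; apply: subclosed_compact cU _; first exact: closed_boundary.
exact: boundary_sub_closure.
Qed.

(** Tube lemma: compactness of the boundary makes the modulus of continuity of
    the kernel in its first variable uniform in the second one. *)
Lemma jointly_continuous_tube (R : realType) (X : pmetricType R) (U : set X)
    (K : X -> X -> R) (x : X) (e : R) :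
  open U -> compact (boundary U) -> jointly_continuous U K -> U x -> 0 < e ->
  \forall x' \near x, U x' /\
    forall z, boundary U z -> `|K x z - K x' z| <= e.
Proof.
move=> oU cB /subspace_continuousP cK Ux e0.
have UN : nbhs x U by exact: open_nbhs_nbhs.
have e2 : 0 < e / 2 by rewrite divr_gt0.
have H : forall z, boundary U z -> \forall z' \near z & x' \near nbhs x,
    boundary U z' -> `|K x z' - K x' z'| <= e.
  move=> z Bz.
  have /cvgrPdist_lt /(_ _ e2) := cK (x, z) (conj Ux Bz).
  rewrite !near_withinE/= => -[[P Q] [/= nP nQ] PQ].
  exists (Q, P `&` U); first by split => //; exact: filterI.
  move=> [z' x'] [/= Qz' [Px' Ux']] Bz'.
  have := PQ (x, z') (conj (nbhs_singleton nP) Qz') (conj Ux Bz').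
  have := PQ (x', z') (conj Px' Qz') (conj Ux' Bz').
  rewrite /= => h1 h2.
  rewrite -(subrKA (K x z)) (le_trans (ler_normD _ _))//.
  rewrite distrC (splitr e) lerD// ltW//.
have := (compact_near_coveringP _).1 cB X (nbhs x)
  (fun x' z => boundary U z -> `|K x z - K x' z| <= e) (nbhs_filter x) H.
apply: filterS2 UN => x' Ux' H'; split => // z Bz.
exact: H'.
Qed.

Lemma kernel_slice_continuous (R : realType) (X : pmetricType R) (U : set X)
    (K : X -> X -> R) (x : X) :
  jointly_continuous U K -> U x -> {within boundary U, continuous (K x)}.
Proof.
move=> /subspace_continuousP cK Ux; apply/subspace_continuousP => z Bz.
apply/cvgrPdist_lt => e e0.
have /cvgrPdist_lt /(_ _ e0) := cK (x, z) (conj Ux Bz).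
rewrite !near_withinE/= => -[[P Q] [/= nP nQ] PQ].
near=> z' => Bz'.
apply: (PQ (x, z')) => //; split => /=; first exact: nbhs_singleton.
by near: z'.
Unshelve. all: by end_near. Qed.

(** * Bounded Borel functions and their harmonic integrals *)

Section BoundedBorel.
Context (R : realType) (X : pmetricType R).
Implicit Types (A B : set X) (f g : X -> R).

Lemma bounded_onP (A : set X) f :
  [bounded f y | y in A] <-> exists M, forall y, A y -> `|f y| <= M.
Proof.
split=> [[M [_ H]]|[M H]].
  by exists (M + 1) => y Ay; apply: (H (M + 1)) => //; rewrite ltrDl.
exists M; split; first exact: num_real.
by move=> x Mx y Ay /=; rewrite (le_trans (H _ Ay))// ltW.
Qed.

Lemma bounded_borel_continuous A f :
  compact A -> {within A, continuous f} -> bounded_borel A f.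
Proof.
by move=> cA cf; split; [exact: within_continuous_borel|
  exact: within_compact_bounded].
Qed.

Lemma bounded_borel_cst A c : bounded_borel A (fun=> c : R).
Proof.
split; first exact: measurable_cst.
by apply/bounded_onP; exists `|c|.
Qed.

Lemma bounded_borelB A f g : bounded_borel A f -> bounded_borel A g ->
  bounded_borel A (fun y => f y - g y).
Proof.
move=> [mf /bounded_onP[M Mf]] [mg /bounded_onP[N Ng]]; split.
  exact: measurable_funB.
apply/bounded_onP; exists (M + N) => y Ay.
by rewrite (le_trans (ler_normB _ _))// lerD ?Mf ?Ng.
Qed.

Lemma bounded_borelD A f g : bounded_borel A f -> bounded_borel A g ->
  bounded_borel A (fun y => f y + g y).
Proof.
move=> [mf /bounded_onP[M Mf]] [mg /bounded_onP[N Ng]]; split.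
  exact: measurable_funD.
apply/bounded_onP; exists (M + N) => y Ay.
by rewrite (le_trans (ler_normD _ _))// lerD ?Mf ?Ng.
Qed.

Lemma bounded_borelM A f g : bounded_borel A f -> bounded_borel A g ->
  bounded_borel A (fun y => f y * g y).
Proof.
move=> [mf /bounded_onP[M Mf]] [mg /bounded_onP[N Ng]]; split.
  exact: measurable_funM.
apply/bounded_onP; exists (M * N) => y Ay.
by rewrite normrM ler_pM ?Mf ?Ng.
Qed.

Lemma bounded_borelZ A c f : bounded_borel A f ->
  bounded_borel A (fun y => c * f y).
Proof. exact/bounded_borelM/bounded_borel_cst. Qed.

Lemma bounded_borel_norm A f : bounded_borel A f ->
  bounded_borel A (fun y => `|f y|).
Proof.
move=> [mf /bounded_onP[M Mf]]; split.
  by apply: measurableT_comp mf; exact: normr_measurable.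
by apply/bounded_onP; exists M => y Ay; rewrite normr_id Mf.
Qed.

Lemma bounded_borel_indic A B : measurable (B : set (borel X)) ->
  bounded_borel A (\1_B : X -> R).
Proof.
move=> mB; split; first exact: (@measurable_indic _ (borel X)).
by apply/bounded_onP; exists 1 => y _; rewrite indicE; case: (_ \in _);
  rewrite ?normr1 ?normr0.
Qed.

Lemma bounded_borel_integrable (mu : probability (borel X) R) A f :
  measurable (A : set (borel X)) -> bounded_borel A f ->
  mu.-integrable A (EFin \o f).
Proof.
move=> mA [mf bf]; apply: measurable_bounded_integrable => //.
by rewrite (le_lt_trans (probability_le1 _ _))// ltry.
Qed.

End BoundedBorel.

Section HarmonicIntegral.
Context (R : realType) (X : pmetricType R).
Variables (omega : set X -> X -> probability (borel X) R).
Implicit Types (U : set X) (f g : X -> R).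

Lemma measurable_boundary U : measurable (boundary U : set (borel X)).
Proof. by apply: closed_borel; exact: closed_boundary. Qed.
Local Hint Resolve measurable_boundary : core.

Lemma hint_eq U x f g : (forall y, boundary U y -> f y = g y) ->
  hint omega U x f = hint omega U x g.
Proof. by move=> fg; apply: eq_Rintegral => y; rewrite inE => /fg. Qed.

Lemma hint_ge0 U x f : (forall y, boundary U y -> 0 <= f y) ->
  0 <= hint omega U x f.
Proof. by move=> f0; apply: Rintegral_ge0. Qed.

Lemma hint_le U x f g : bounded_borel (boundary U) f ->
  bounded_borel (boundary U) g -> (forall y, boundary U y -> f y <= g y) ->
  hint omega U x f <= hint omega U x g.
Proof.
by move=> bf bg fg; apply: le_Rintegral => //; exact: bounded_borel_integrable.
Qed.

Lemma hintB U x f g : bounded_borel (boundary U) f ->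
  bounded_borel (boundary U) g ->
  hint omega U x (fun y => f y - g y) = hint omega U x f - hint omega U x g.
Proof.
by move=> bf bg; apply: RintegralB => //; exact: bounded_borel_integrable.
Qed.

Lemma hintD U x f g : bounded_borel (boundary U) f ->
  bounded_borel (boundary U) g ->
  hint omega U x (fun y => f y + g y) = hint omega U x f + hint omega U x g.
Proof.
by move=> bf bg; apply: RintegralD => //; exact: bounded_borel_integrable.
Qed.

Lemma hintZ U x c f : bounded_borel (boundary U) f ->
  hint omega U x (fun y => c * f y) = c * hint omega U x f.
Proof.
by move=> bf; apply: RintegralZl => //; exact: bounded_borel_integrable.
Qed.

Lemma hint_norm U x f : bounded_borel (boundary U) f ->
  `|hint omega U x f| <= hint omega U x (fun y => `|f y|).
Proof.
by move=> bf; apply: le_normr_Rintegral => //; exact: bounded_borel_integrable.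
Qed.

Lemma hint_cst U x c : harmonic_measure omega U -> U x ->
  hint omega U x (fun=> c) = c.
Proof.
move=> [H _] Ux; rewrite /hint Rintegral_cst// -[RHS]mulr1; congr (_ * _).
by transitivity (fine (1%E : \bar R)) => //; congr fine; exact: H.
Qed.

Lemma hint_kernel U x0 K x f : harmonic_measure omega U -> U x0 -> U x ->
  kernel_version omega U x0 K -> bounded_borel (boundary U) (K x) ->
  bounded_borel (boundary U) f ->
  hint omega U x f = hint omega U x0 (fun y => K x y * f y).
Proof.
move=> [_ ac] Ux0 Ux Kv bK bf; rewrite /hint /Rintegral; congr fine.
have dom_x : omega U x `<< omega U x0 by exact: ac.
rewrite -(Radon_Nikodym_change_of_variables dom_x)//; last first.
  exact: bounded_borel_integrable.
apply: ae_eq_integral => //.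
- apply: emeasurable_funM; first by apply/measurable_EFinP; case: bf.
  apply: measurable_funTS; apply: measurable_int.
  exact: Radon_Nikodym_integrable.
- by apply/measurable_EFinP; case: (bounded_borelM bK bf).
- have [N [mN N0 sN]] := Kv _ Ux; exists N; split => // y /= H.
  apply: sN => /= KRN; apply: H => By.
  by rewrite -KRN// -EFinM mulrC.
Qed.

End HarmonicIntegral.

(** * Oscillation of harmonic integrals and of kernels *)

Section Kernel.
Context (R : realType) (X : pmetricType R).
Variables (dom : set (set X)) (omega : set X -> X -> probability (borel X) R).
Hypothesis fw : framework omega dom.
Implicit Types (U V W : set X) (f g u v : X -> R).

Lemma hint_continuous U f : dom U -> bounded_borel (boundary U) f ->
  {within U, continuous (fun x => hint omega U x f)}.
Proof.
move=> dU bf; apply: (fw_continuous fw dU) => x Ux; exists f.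
  by apply: bounded_borel_integrable => //; exact: measurable_boundary.
by apply: aeW.
Qed.

(** By the tower property, the harmonic integral of [f] on [U] is on [V] the
    integral of [K x z * g z] for the measure of [V] at [x0], where [g] is that
    integral itself.  Since the integral of [g] is the value at [x0], the
    oscillation of [K] bounds that of the harmonic integral, relatively to its
    value at [x0]. *)
Lemma hint_kernel_dist U V x0 K x x' e f :
  dom U -> dom V -> regular omega V -> compactly_contained V U ->
  V x0 -> V x -> V x' ->
  kernel_version omega V x0 K -> jointly_continuous V K ->
  (forall z, boundary V z -> `|K x z - K x' z| <= e) ->
  bounded_borel (boundary U) f -> (forall y, boundary U y -> 0 <= f y) ->
  `|hint omega U x f - hint omega U x' f| <= e * hint omega U x0 f.
Proof.
move=> dU dV rV VU Vx0 Vx Vx' vK cK Ke bf f0.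
pose g z := hint omega U z f.
have cV := compact_boundary VU.
have BVU : boundary V `<=` U.
  by apply: subset_trans VU.2; exact: boundary_sub_closure.
have bg : bounded_borel (boundary V) g.
  apply: bounded_borel_continuous => //.
  by apply: continuous_subspaceW (hint_continuous dU bf).
have bK y : V y -> bounded_borel (boundary V) (K y).
  move=> Vy; apply: bounded_borel_continuous => //.
  exact: kernel_slice_continuous cK Vy.
have hmV := fw_hm fw dV.
rewrite !(fw_tower fw dV dU VU rV)// -/g.
rewrite (hint_kernel hmV Vx0 Vx vK (bK _ Vx) bg).
rewrite (hint_kernel hmV Vx0 Vx' vK (bK _ Vx') bg).
have bKg y : V y -> bounded_borel (boundary V) (fun z => K y z * g z).
  by move=> Vy; apply: bounded_borelM => //; exact: bK.
rewrite -hintB; [|exact: bKg|exact: bKg].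
rewrite -hintZ//.
have bb : bounded_borel (boundary V) (fun y => K x y * g y - K x' y * g y).
  by apply: bounded_borelB; exact: bKg.
apply: le_trans (hint_norm _ _ bb) _; apply: hint_le.
- exact: bounded_borel_norm.
- exact: bounded_borelZ.
- move=> z Bz; rewrite -mulrBl normrM (@ger0_norm _ (g z)).
    by rewrite ler_wpM2r ?Ke//; apply: hint_ge0.
  exact: hint_ge0.
Qed.

(** Regularity makes the harmonic measure charge every relatively open part of
    the boundary: if [O] were null for [x0], it would be null for all [x] in
    [U], whereas its measure tends to 1 as [x] tends to [zeta]. *)
Lemma hint_indic_gt0 U x0 K O zeta :
  dom U -> regular omega U -> compact (boundary U) -> U x0 ->
  kernel_version omega U x0 K -> jointly_continuous U K ->
  open O -> O zeta -> boundary U zeta -> 0 < hint omega U x0 (\1_O).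
Proof.
move=> dU rU cU Ux0 vK cK oO Oz Bz.
have b1 : bounded_borel (boundary U) (\1_O : X -> R).
  by apply: bounded_borel_indic; exact: open_borel.
rewrite lt_neqAle hint_ge0 ?andbT; last by move=> y _; rewrite indicE.
apply/eqP => H0.
have H x : U x -> hint omega U x \1_O = 0.
  move=> Ux; have bK : bounded_borel (boundary U) (K x).
    apply: bounded_borel_continuous => //.
    exact: kernel_slice_continuous cK Ux.
  rewrite (hint_kernel (fw_hm fw dU) Ux0 Ux vK bK b1).
  have [_ /bounded_onP[M HM]] := bK.
  have bb := bounded_borelM bK b1.
  have : `|hint omega U x0 (fun y => K x y * \1_O y)|
      <= M * hint omega U x0 \1_O.
    rewrite -hintZ//; apply: le_trans (hint_norm _ _ bb) _.
    apply: hint_le => //.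
    + exact: bounded_borel_norm.
    + by apply: bounded_borelZ.
    + move=> y By; rewrite normrM (@ger0_norm _ (\1_O y)) ?indicE//.
      by rewrite ler_wpM2r// HM.
  by rewrite -H0 mulr0 normr_le0 => /eqP.
have : hint omega U x \1_O @[x --> within U (nbhs zeta)] --> (\1_O zeta : R).
  apply: rU => //; apply: cvg_near_cst; apply: cvg_within.
  apply: filterS (open_nbhs_nbhs (conj oO Oz)) => y Oy.
  by rewrite !indicE !mem_set.
move=> /cvgrPdist_lt/(_ 1 ltr01); rewrite near_withinE => N1.
have clz : closure U zeta by exact: boundary_sub_closure Bz.
have [x [Ux /(_ Ux)]] := clz _ N1.
by rewrite H// indicE mem_set// subr0 normr1 ltxx.
Qed.

(** The pointwise value of a continuous kernel is recovered from the harmonic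
    measures alone, as a limit of quotients over small neighbourhoods of [zeta];
    this is how properties of harmonic integrals pass to the kernel at every
    boundary point, and not only at almost every one. *)
Lemma kernel_near_ratio U x0 K x zeta e :
  dom U -> compact (boundary U) -> U x0 -> U x ->
  kernel_version omega U x0 K -> jointly_continuous U K ->
  boundary U zeta -> 0 < e ->
  exists2 P, nbhs zeta P & forall O, open O -> O `<=` P ->
    `|hint omega U x \1_O - K x zeta * hint omega U x0 \1_O|
      <= e * hint omega U x0 \1_O.
Proof.
move=> dU cU Ux0 Ux vK cK Bz e0.
have cKx := kernel_slice_continuous cK Ux.
have bK : bounded_borel (boundary U) (K x) by exact: bounded_borel_continuous.
have /subspace_continuousP/(_ _ Bz)/cvgrPdist_lt/(_ _ e0) := cKx.
rewrite near_withinE => NP; eexists; first exact: NP.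
move=> O oO OP.
have b1 : bounded_borel (boundary U) (\1_O : X -> R).
  by apply: bounded_borel_indic; exact: open_borel.
rewrite (hint_kernel (fw_hm fw dU) Ux0 Ux vK bK b1) -!hintZ//.
have b2 := bounded_borelM bK b1.
have b3 := bounded_borelZ (K x zeta) b1.
rewrite -hintB//.
have b4 := bounded_borelB b2 b3.
apply: le_trans (hint_norm _ _ b4) _; apply: hint_le => //.
- exact: bounded_borel_norm.
- exact: bounded_borelZ.
- move=> y By; rewrite -mulrBl normrM (@ger0_norm _ (\1_O y)) ?indicE//.
  case: (boolP (y \in O)) => [|_]; last by rewrite !mulr0.
  by rewrite inE !mulr1 distrC => Oy; exact/ltW/(OP _ Oy By).
Qed.

(** [hint_kernel_dist] for the indicator functions of small neighbourhoods of
    [zeta], divided by the measure of these neighbourhoods. *)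
Lemma kernel_dist U V x0 KU K x x' e zeta :
  dom U -> dom V -> regular omega U -> regular omega V ->
  compact (boundary U) -> compactly_contained V U -> V x0 -> V x -> V x' ->
  kernel_version omega U x0 KU -> jointly_continuous U KU ->
  kernel_version omega V x0 K -> jointly_continuous V K ->
  (forall z, boundary V z -> `|K x z - K x' z| <= e) -> boundary U zeta ->
  `|KU x zeta - KU x' zeta| <= e.
Proof.
move=> dU dV rU rV cU VU Vx0 Vx Vx' vKU cKU vK cK Ke Bz.
have sVU : V `<=` U by apply: subset_trans VU.2; exact: subset_closure.
apply/ler_addgt0Pr => d d0.
have d2 : 0 < d / 2 by rewrite divr_gt0.
have Ux0 := sVU _ Vx0.
have [P nP HP] := kernel_near_ratio dU cU Ux0 (sVU _ Vx) vKU cKU Bz d2.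
have [Q nQ HQ] := kernel_near_ratio dU cU Ux0 (sVU _ Vx') vKU cKU Bz d2.
have nPQ : nbhs zeta (P `&` Q) by exact: filterI.
have [ O [oO Oz] OPQ] : exists2 O, open_nbhs zeta O & O `<=` P `&` Q.
  by move: nPQ; rewrite nbhsE.
have m0 := hint_indic_gt0 dU rU cU Ux0 vKU cKU oO Oz Bz.
have {}HP := HP _ oO (subset_trans OPQ (@subIsetl _ _ _)).
have {}HQ := HQ _ oO (subset_trans OPQ (@subIsetr _ _ _)).
have b1 : bounded_borel (boundary U) (\1_O : X -> R).
  by apply: bounded_borel_indic; exact: open_borel.
have i0 y : boundary U y -> 0 <= (\1_O y : R) by rewrite indicE.
have H := hint_kernel_dist dU dV rV VU Vx0 Vx Vx' vK cK Ke b1 i0.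
set m := hint omega U x0 _ in m0 HP HQ H.
set p := hint omega U x _ in HP H; set q := hint omega U x' _ in HQ H.
rewrite -(ler_pM2r m0) -[in leLHS](gtr0_norm m0) -normrM mulrBl.
move: HP HQ H; rewrite !ler_norml => /andP[? ?] /andP[? ?] /andP[? ?].
by apply/andP; split; lra.
Qed.

End Kernel.

(** * Harmonic functions and limits *)

Lemma harmonic_lincomb (R : realType) (X : pmetricType R) dom
    (omega : set X -> X -> probability (borel X) R) W u v (a b : R) :
  Defs.harmonic omega dom W u -> Defs.harmonic omega dom W v ->
  Defs.harmonic omega dom W (fun x => a * u x - b * v x).
Proof.
move=> [cu Hu] [cv Hv]; split.
  apply/subspace_continuousP => x Wx.
  apply: cvgB; apply: cvgM; try exact: cvg_cst.
  - by move/subspace_continuousP : cu; apply.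
  - by move/subspace_continuousP : cv; apply.
move=> V x dV rV VW Vx.
have bb w : {within W, continuous w} -> bounded_borel (boundary V) w.
  move=> cw; apply: bounded_borel_continuous; first exact: compact_boundary VW.
  by apply: continuous_subspaceW cw; apply: subset_trans VW.2;
    exact: boundary_sub_closure.
have [bu bv] := (bb _ cu, bb _ cv).
rewrite hintB; try exact: bounded_borelZ.
by rewrite !hintZ// -Hu// -Hv.
Qed.

(** Along any filter, equicontinuity upgrades pointwise convergence to uniform
    convergence on compact sets. *)
Lemma equicontinuous_uniform (R : realType) (T : topologicalType) (I : Type)
    (G : set_system I) {FG : Filter G} (v : I -> T -> R) (u : T -> R)
    (C : set T) :
  compact C -> (forall x, C x -> v i x @[i --> G] --> u x) ->
  (forall x e, C x -> 0 < e -> \forall x' \near x, `|u x - u x'| <= e) ->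
  (forall x e, C x -> 0 < e ->
    \forall x' \near x & i \near G, `|v i x - v i x'| <= e) ->
  forall e, 0 < e -> \forall i \near G, forall x, C x -> `|v i x - u x| <= e.
Proof.
move=> cC vu cu cv e e0.
have e3 : 0 < e / 3 by rewrite divr_gt0.
apply: ((compact_near_coveringP _).1 cC I G
  (fun i x => `|v i x - u x| <= e)) => x Cx.
have /cvgrPdist_le/(_ _ e3) N1 := vu x Cx.
have N2 := cu _ _ Cx e3; have [[P Q] /= [nP nQ] PQ] := cv _ _ Cx e3.
exists ([set x' | `|u x - u x'| <= e / 3] `&` P,
        [set i | `|u x - v i x| <= e / 3] `&` Q) => [|[x' i] /=].
  by split; exact: filterI.
move=> [[H2 Px'] [H1 Qi]]; have /= H3 := PQ (x', i) (conj Px' Qi).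
move: H1 H2 H3; rewrite !ler_norml => /andP[? ?] /andP[? ?] /andP[? ?].
by apply/andP; split; lra.
Qed.

Lemma fmap_ultra (T U : Type) (f : T -> U) (F : set_system T) :
  UltraFilter F -> UltraFilter (f @ F).
Proof.
move=> UF; split; first exact: fmap_proper_filter.
move=> G PG FG; apply/seteqP; split=> // A GA.
have [//|FnA] := in_ultra_setVsetC (f @^-1` A) UF.
have GnA : G (~` A) by exact: FG.
by have [x []] := filter_ex (filterI GA GnA).
Qed.

Lemma cvg_near_eq (R : realType) (a b : nat -> R) (l : R) :
  a n @[n --> \oo] --> l -> (\forall n \near \oo, b n = a n) ->
  b n @[n --> \oo] --> l.
Proof.
move=> /cvgrPdist_lt al ab; apply/cvgrPdist_lt => e e0.
by apply: filterS2 (al e e0) ab => n + ->.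
Qed.

Lemma cvg0Z (R : realType) (a : nat -> R) (c : R) :
  a n @[n --> \oo] --> (0 : R) -> c * a n @[n --> \oo] --> (0 : R).
Proof. by move=> a0; rewrite -(mulr0 c); apply: cvgM a0; exact: cvg_cst. Qed.

(** * Exhaustions, ultrafilter limits and convergence in mass *)

Section Exhaustion.
Context (R : realType) (X : pmetricType R).
Variables (dom : set (set X)) (omega : set X -> X -> probability (borel X) R).
Variables (D : set X) (x0 : X) (Dn : nat -> set X) (K : nat -> X -> X -> R).
Hypothesis fw : framework omega dom.
Hypothesis Dn_dom : forall n, dom (Dn n).
Hypothesis Dn_regular : forall n, regular omega (Dn n).
Hypothesis Dn0_x0 : Dn 0%N x0.
Hypothesis Dn_incr : forall n, compactly_contained (Dn n) (Dn n.+1).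
Hypothesis D_union : D = \bigcup_n Dn n.
Hypothesis K_version : forall n, kernel_version omega (Dn n) x0 (K n).
Hypothesis K_continuous : forall n, jointly_continuous (Dn n) (K n).

Lemma exhaustion_sub m n : (m <= n)%N -> Dn m `<=` Dn n.
Proof.
elim: n => [|n IH]; first by rewrite leqn0 => /eqP ->.
rewrite leq_eqVlt => /predU1P[->//|]; rewrite ltnS => /IH mn.
by apply: subset_trans mn (subset_trans _ (Dn_incr n).2); exact: subset_closure.
Qed.

Lemma exhaustion_compactly_contained m n :
  (m < n)%N -> compactly_contained (Dn m) (Dn n).
Proof.
move=> mn; split; first exact: (Dn_incr m).1.
exact: subset_trans (Dn_incr m).2 (exhaustion_sub mn).
Qed.

Lemma exhaustion_subD n : Dn n `<=` D.
Proof. by rewrite D_union; exact: bigcup_sup. Qed.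

Lemma exhaustion_compactly_containedD n : compactly_contained (Dn n) D.
Proof.
split; first exact: (Dn_incr n).1.
exact: subset_trans (Dn_incr n).2 (@exhaustion_subD _).
Qed.

Lemma exhaustion_boundary_sub n : boundary (Dn n) `<=` D.
Proof.
apply: subset_trans (exhaustion_compactly_containedD n).2.
exact: boundary_sub_closure.
Qed.

Lemma exhaustion_open n : open (Dn n).
Proof. by case: (fw_domain fw (Dn_dom n)). Qed.

Lemma exhaustion_x0 n : Dn n x0.
Proof. exact: exhaustion_sub Dn0_x0. Qed.

Lemma exhaustion_compact_boundary n : compact (boundary (Dn n)).
Proof. exact: compact_boundary (Dn_incr n). Qed.

Lemma near_exhaustion (C : set X) : compact C -> C `<=` D ->
  \forall n \near \oo, C `<=` Dn n.
Proof.
move=> cC CD; apply: ((compact_near_coveringP _).1 cC nat \oo Dn) => x Cx.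
have := CD _ Cx; rewrite D_union => -[m _ Dmx].
exists (Dn m, [set n | (m <= n)%N]) => [|[y n] /= [Dmy mn]].
  split => /=; last exact: nbhs_infty_ge.
  by apply: open_nbhs_nbhs; split => //; exact: exhaustion_open.
exact: exhaustion_sub Dmy.
Qed.

Lemma near_exhaustion_pt x : D x -> \forall n \near \oo, Dn n x.
Proof.
move=> Dx; have := near_exhaustion (@compact_set1 _ x).
have x1D : [set x] `<=` D by move=> _ ->.
by move=> /(_ x1D); apply: filterS => n; exact.
Qed.

(** Equicontinuity at [x] of all harmonic integrals and kernels of the later
    domains of the exhaustion, with one neighbourhood of [x] for all of them. *)
Lemma exhaustion_oscillation x (e : R) : D x -> 0 < e ->
  exists m, \forall x' \near x, Dn m x' /\ forall n, (m < n)%N ->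
    (forall f, bounded_borel (boundary (Dn n)) f ->
      (forall y, boundary (Dn n) y -> 0 <= f y) ->
      `|hint omega (Dn n) x f - hint omega (Dn n) x' f|
        <= e * hint omega (Dn n) x0 f) /\
    (forall y, boundary (Dn n) y -> `|K n x y - K n x' y| <= e).
Proof.
rewrite {1}D_union => -[m _ Dmx] e0; exists m.
have := jointly_continuous_tube (exhaustion_open m)
  (@exhaustion_compact_boundary m) (@K_continuous m) Dmx e0.
apply: filterS => x' [Dmx' HK]; split => // n mn.
have cc := exhaustion_compactly_contained mn.
split=> [f bf f0|y By].
  exact: (hint_kernel_dist fw (Dn_dom n) (Dn_dom m) (@Dn_regular m) cc
    (exhaustion_x0 m) Dmx Dmx' (@K_version m) (@K_continuous m) HK bf f0).
exact: (kernel_dist fw (Dn_dom n) (Dn_dom m) (@Dn_regular n) (@Dn_regular m)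
  (@exhaustion_compact_boundary n) cc (exhaustion_x0 m) Dmx Dmx'
  (@K_version n) (@K_continuous n) (@K_version m) (@K_continuous m) HK By).
Qed.

Lemma kernel_bounded_borel n x : Dn n x ->
  bounded_borel (boundary (Dn n)) (K n x).
Proof.
move=> Dnx; apply: bounded_borel_continuous.
  exact: exhaustion_compact_boundary.
exact: kernel_slice_continuous (@K_continuous n) Dnx.
Qed.

Variable h : X -> R.
Hypothesis h_extreme : extreme_harmonic omega dom D x0 h.

Lemma harmonic_bounded_borel n u : {within D, continuous u} ->
  bounded_borel (boundary (Dn n)) u.
Proof.
move=> cu; apply: bounded_borel_continuous.
  exact: exhaustion_compact_boundary.
by apply: continuous_subspaceW cu; exact: exhaustion_boundary_sub.
Qed.

Lemma exhaustion_mean n x : Dn n x -> h x = hint omega (Dn n) x h.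
Proof.
move=> Dx; have [[[_ +] _ _] _] := h_extreme; apply => //.
exact: exhaustion_compactly_containedD.
Qed.

Section UltraLimit.
Variable f : nat -> X -> R.
Hypothesis bf : forall n, bounded_borel (boundary (Dn n)) (f n).
Hypothesis f_ge0 : forall n y, boundary (Dn n) y -> 0 <= f n y.
Hypothesis f_le : forall n y, boundary (Dn n) y -> f n y <= h y.
Variable G : set_system nat.
Hypothesis UG : UltraFilter G.
Hypothesis ooG : \oo `<=` G.

Let v n x := hint omega (Dn n) x (f n).

Let v_bounds n x : Dn n x -> 0 <= v n x <= h x.
Proof.
move=> Dx; apply/andP; split; first by apply: hint_ge0; exact: f_ge0.
rewrite (exhaustion_mean Dx); apply: hint_le; [exact: bf| |exact: f_le].
by apply: harmonic_bounded_borel; case: h_extreme => -[[]].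
Qed.

Let v_cvg x : D x -> exists l : R, v n x @[n --> G] --> l.
Proof.
move=> Dx; have := @segment_compact R 0 (h x); rewrite compact_ultra => cpt.
have Gv : (v n x @[n --> G]) [set` `[0, h x]].
  apply: ooG; apply: filterS (near_exhaustion_pt Dx) => n Dnx /=.
  by rewrite in_itv /=; exact: v_bounds.
have [l [_ Hl]] := cpt _ (fmap_ultra _ _) Gv.
by exists l.
Qed.

Let u x := lim (v n x @[n --> G]).

Let v_cvg_u x : D x -> v n x @[n --> G] --> u x.
Proof. by move=> /v_cvg[l vl]; apply/cvg_ex; exists l. Qed.

Let v_x0_le1 n : v n x0 <= 1.
Proof.
have /andP[_] := v_bounds (exhaustion_x0 n).
by have [[_ _ ->] _] := h_extreme.
Qed.

Let v_equicontinuous x (e : R) : D x -> 0 < e ->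
  exists m, \forall x' \near x, Dn m x' /\
    forall n, (m < n)%N -> `|v n x - v n x'| <= e.
Proof.
move=> Dx e0; have [m Hm] := exhaustion_oscillation Dx e0; exists m.
apply: filterS Hm => x' [Dx' H]; split => // n mn.
have [+ _] := H n mn => /(_ (f n) (bf n) (@f_ge0 n)) /le_trans; apply.
by apply: ler_piMr; [exact: ltW|exact: v_x0_le1].
Qed.

Let u_continuous x (e : R) : D x -> 0 < e ->
  \forall x' \near x, `|u x - u x'| <= e.
Proof.
move=> Dx e0; have [m Hm] := v_equicontinuous Dx e0.
apply: filterS Hm => x' [Dx' H].
have cv : `|v n x - v n x'| @[n --> G] --> `|u x - u x'|.
  apply: cvg_norm; apply: cvgB; apply: v_cvg_u => //.
  exact: exhaustion_subD Dx'.
apply: cvgr_to_le cv _.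
by apply: ooG; exists m.+1.
Qed.

Let v_uniform C (e : R) : compact C -> C `<=` D -> 0 < e ->
  \forall n \near G, forall x, C x -> `|v n x - u x| <= e.
Proof.
move=> cC CD; apply: equicontinuous_uniform => // [x Cx|x d Cx d0|x d Cx d0].
- exact/v_cvg_u/CD.
- exact/u_continuous/d0/CD.
have [m Hm] := v_equicontinuous (CD _ Cx) d0.
exists ([set x' | Dn m x' /\ forall n, (m < n)%N -> `|v n x - v n x'| <= d],
  [set n | (m < n)%N]) => [|[x' n] /= [[_ +] mn]]; last exact.
by split => //=; apply: ooG; exists m.+1.
Qed.

(** Local uniformity of the convergence is what allows the limit to pass under
    the integrals of the mean value property. *)
Lemma ultralimit_harmonic : Defs.harmonic omega dom D u.
Proof.
have cu : {within D, continuous u}.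
  apply/subspace_continuousP => x Dx; apply: cvg_within_filter.
  by apply/cvgrPdist_le => e e0; exact: u_continuous.
split => // V x dV rV VD Vx.
have cV := compact_boundary VD.
have BV : boundary V `<=` closure V by exact: boundary_sub_closure.
have bu : bounded_borel (boundary V) u.
  apply: bounded_borel_continuous => //.
  by apply: continuous_subspaceW cu; apply: subset_trans VD.2.
apply/eqP; rewrite -subr_eq0 -normr_le0; apply/ler_addgt0Pr => e e0.
rewrite add0r.
have e2 : 0 < e / 2 by rewrite divr_gt0.
have : \forall n \near G, closure V `<=` Dn n.
  by apply: ooG; exact: near_exhaustion VD.1 VD.2.
move=> /filterI /(_ (v_uniform VD.1 VD.2 e2)) /filter_ex[n [VDn vu]].
have bv : bounded_borel (boundary V) (v n).
  apply: bounded_borel_continuous => //.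
  apply: continuous_subspaceW (hint_continuous fw (Dn_dom n) (bf n)).
  exact: subset_trans VDn.
have vx : v n x = hint omega V x (v n).
  by apply: (fw_tower fw) => //; split => //; exact: VD.1.
have H1 := vu x (subset_closure Vx).
have bvu := bounded_borelB bv bu.
have H2 : `|hint omega V x (v n) - hint omega V x u| <= e / 2.
  rewrite -hintB//; apply: le_trans (hint_norm _ _ bvu) _.
  rewrite -[leRHS](hint_cst (e / 2) (fw_hm fw dV) Vx); apply: hint_le.
  - exact: bounded_borel_norm.
  - exact: bounded_borel_cst.
  - by move=> y /BV; exact: vu.
move: H1 H2; rewrite vx !ler_norml => /andP[? ?] /andP[? ?].
by apply/andP; split; lra.
Qed.

(** The decomposition [h = t * h1 + (1 - t) * h2] is made with [h1] and [h2]
    proportional to [h + u] and [h + (h - u)] rather than to [u] and [h - u]: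
    both are then strictly positive because [h] is, and the cases [u x0 = 0] and
    [u x0 = 1] are not exceptional. *)
Lemma ultralimit_extreme x : D x -> u x = u x0 * h x.
Proof.
move=> Dx; have [[hh h0 hx0] hext] := h_extreme.
have hu := ultralimit_harmonic.
have Dx0 : D x0 by exact: exhaustion_subD (exhaustion_x0 0).
have ub y : D y -> 0 <= u y <= h y.
  move=> Dy; have cy := v_cvg_u Dy.
  have nD : \forall n \near G, 0 <= v n y <= h y.
    by apply: ooG; apply: filterS (near_exhaustion_pt Dy) => n /v_bounds.
  apply/andP; split.
    by apply: cvgr_to_ge cy _; apply: filterS nD => n /andP[].
  by apply: cvgr_to_le cy _; apply: filterS nD => n /andP[].
set a := u x0; have := ub _ Dx0; rewrite hx0 -/a => /andP[a0 a1].
have a1p : 0 < 1 + a by lra.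
have a2p : 0 < 2 - a by lra.
pose h1 y := (1 + a)^-1 * h y - (- (1 + a)^-1) * u y.
pose h2 y := 2 * (2 - a)^-1 * h y - (2 - a)^-1 * u y.
have H1 : positive_harmonic1 omega dom D x0 h1.
  split; first exact: harmonic_lincomb.
    move=> y Dy; have /andP[u0 u1] := ub _ Dy; have := h0 _ Dy => hy.
    by rewrite /h1 mulNr opprK -mulrDr mulr_gt0 ?invr_gt0// ltr_pwDl.
  by rewrite /h1 hx0 -/a; field; rewrite gt_eqF.
have H2 : positive_harmonic1 omega dom D x0 h2.
  split; first exact: harmonic_lincomb.
    move=> y Dy; have /andP[u0 u1] := ub _ Dy; have := h0 _ Dy => hy.
    rewrite /h2 mulrAC mulrC -mulrBr mulr_gt0 ?invr_gt0//; lra.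
  by rewrite /h2 hx0 -/a; field; rewrite gt_eqF.
(* The weight [t] is [h1]'s normalizing factor [1 + a] over the sum [3] of
   those of [h1] and [h2]. *)
have t01 : 0 < (1 + a) / 3 < 1 by apply/andP; split; lra.
have [] := hext h1 h2 _ H1 H2 t01 _ x Dx.
  move=> y Dy; rewrite /h1 /h2; field.
  by rewrite !gt_eqF.
move=> + _; rewrite /h1 mulNr opprK -mulrDr => E.
have := congr1 (fun r => (1 + a) * r) E.
by rewrite /= mulrA divff ?mul1r ?gt_eqF// mulrDl mul1r => /addrI.
Qed.

Lemma ultralimit_defect x : D x ->
  v n x - h x * v n x0 @[n --> G] --> (0 : R).
Proof.
move=> Dx; have Dx0 : D x0 by exact: exhaustion_subD (exhaustion_x0 0).
have := cvgB (v_cvg_u Dx) (cvgM (cvg_cst (h x)) (v_cvg_u Dx0)).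
rewrite (_ : u x - h x * u x0 = 0); first exact.
by rewrite ultralimit_extreme// mulrC subrr.
Qed.

End UltraLimit.

(** If the sequence stayed away from zero along infinitely many indices, an
    ultrafilter containing that set of indices would contradict
    [ultralimit_defect]. *)
Lemma defect_cvg (f : nat -> X -> R) x :
  (forall n, bounded_borel (boundary (Dn n)) (f n)) ->
  (forall n y, boundary (Dn n) y -> 0 <= f n y) ->
  (forall n y, boundary (Dn n) y -> f n y <= h y) -> D x ->
  hint omega (Dn n) x (f n) - h x * hint omega (Dn n) x0 (f n)
    @[n --> \oo] --> (0 : R).
Proof.
move=> bf f0 fh Dx; set d := fun n => _.
apply/cvgrPdist_lt => e e0; apply: contrapT => nN.
pose B := [set n | ~ `|0 - d n| < e].
have PB : ProperFilter (within B \oo).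
  apply: Build_ProperFilter_ex => P; rewrite /within/= => BP.
  apply: contrapT => nP; apply: nN; apply: filterS BP => n BP.
  by apply: contrapT => Bn; apply: nP; exists n; exact: BP.
have [G [UG BG]] := ultraFilterLemma PB.
have ooG : \oo `<=` G by move=> P oP; apply: BG; exact: cvg_within oP.
have GB : G B by apply: BG; exact: withinT.
have /cvgrPdist_lt/(_ e e0) Gd := ultralimit_defect bf f0 fh UG ooG Dx.
by have [n []] := filter_ex (filterI GB Gd).
Qed.

(** Both [K n x] and the constant [h x] have integral [h x] against [mu_n], so
    the mean distance is twice the integral of the positive part of their
    difference, which is the defect of [h] cut down to the set [A n] where
    [K n x > h x]. *)
Lemma kernel_mean_dist x : D x ->
  hint omega (Dn n) x0 (fun y => `|K n x y - h x| * h y)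
    @[n --> \oo] --> (0 : R).
Proof.
move=> Dx; have [[[ch _] h0 hx0] _] := h_extreme.
have bh n : bounded_borel (boundary (Dn n)) h by exact: harmonic_bounded_borel.
(* The clause [Dn n x] makes [A n] empty, hence Borel, as long as [x] has not
   entered the exhaustion. *)
pose A n := [set y | [/\ Dn n x, boundary (Dn n) y & 0 < K n x y - h x]].
have mA n : measurable (A n : set (borel X)).
  have [Dnx|nDnx] := pselect (Dn n x); last first.
    rewrite (_ : A n = set0); first exact: (@measurable0 _ (borel X)).
    by apply/seteqP; split=> y // [].
  have bKn := kernel_bounded_borel Dnx.
  have [mt _] := bounded_borelB bKn (bounded_borel_cst _ (h x)).
  have := mt (measurable_boundary _) _ (measurable_itv `]0, +oo[).
  congr measurable; apply/seteqP; split=> y /=; rewrite in_itv/= andbT.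
    by move=> [].
  by move=> [].
pose f n y := \1_(A n) y * h y.
have hge0 n y : boundary (Dn n) y -> 0 <= h y.
  by move=> /exhaustion_boundary_sub/h0/ltW.
have bA n : bounded_borel (boundary (Dn n)) (\1_(A n) : X -> R).
  exact: bounded_borel_indic.
have bf n : bounded_borel (boundary (Dn n)) (f n) by exact: bounded_borelM.
have f0 n y : boundary (Dn n) y -> 0 <= f n y.
  by move=> By; rewrite mulr_ge0 ?(hge0 n)// indicE.
have fh n y : boundary (Dn n) y -> f n y <= h y.
  by move=> By; rewrite ler_piMl ?(hge0 n)// indicE lern1 leq_b1.
apply: (cvg_near_eq (cvg0Z 2 (defect_cvg bf f0 fh Dx))).
apply: filterS (near_exhaustion_pt Dx) => n Dnx /=.
have bKn := kernel_bounded_borel Dnx.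
have hm := fw_hm fw (Dn_dom n).
rewrite (hint_kernel hm (exhaustion_x0 n) Dnx (@K_version n) bKn (bf n)).
have bKf := bounded_borelM bKn (bf n).
have bKh := bounded_borelM bKn (bh n).
have -> : hint omega (Dn n) x0 (fun y => `|K n x y - h x| * h y) =
    hint omega (Dn n) x0 (fun y => 2 * (K n x y * f n y - h x * f n y) -
      (K n x y * h y - h x * h y)).
  apply: hint_eq => y By; rewrite /f indicE.
  have [yA|yA] := boolP (y \in A n).
    have := yA; rewrite inE => -[_ _ /ltW t0].
    by rewrite ger0_norm//=; ring.
  have t0 : K n x y - h x <= 0.
    by rewrite leNgt; apply: contra yA => t0; rewrite inE.
  by rewrite ler0_norm//=; ring.
have b1 := bounded_borelB bKf (bounded_borelZ (h x) (bf n)).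
have b2 := bounded_borelB bKh (bounded_borelZ (h x) (bh n)).
rewrite hintB//; last exact: bounded_borelZ.
rewrite hintZ// hintB//; last exact: bounded_borelZ.
rewrite hintB//; last exact: bounded_borelZ.
rewrite !hintZ//.
rewrite -(hint_kernel hm (exhaustion_x0 n) Dnx (@K_version n) bKn (bh n)).
by rewrite -!exhaustion_mean ?hx0 ?mulr1 ?subrr ?subr0//; exact: exhaustion_x0.
Qed.

(** Convergence in [mu_n]-measure as a filter: [E] belongs to it when, outside
    [E], the mass of the boundary tends to zero.  The mass of the exceptional
    set is bounded through a Borel majorant [g] of its indicator, so that
    Markov's inequality is built in and [E] may fail to be measurable.  Being a
    filter, it can be fed to the covering form of compactness, which replaces
    the choice of a finite net of points. *)
Definition mass_filter : set_system (nat * X) := fun E =>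
  exists g : nat -> X -> R,
    (\forall n \near \oo, bounded_borel (boundary (Dn n)) (g n) /\
      forall y, boundary (Dn n) y ->
        0 <= g n y /\ (~ E (n, y) -> 1 <= g n y)) /\
    hint omega (Dn n) x0 (fun y => g n y * h y) @[n --> \oo] --> (0 : R).

Lemma mass_filter_filter : Filter mass_filter.
Proof.
have [[[ch _] _ _] _] := h_extreme; split.
- exists (fun _ _ => 0); split.
    apply: nearW => n; split; first exact: (bounded_borel_cst _ 0).
    by move=> y _; split => // nT; exfalso; exact: nT.
  apply: cvg_near_cst; apply: nearW => n.
  have -> : (fun y => 0 * h y) = (fun y => 0 * (0 * h y)).
    by apply/funext => y; rewrite !mul0r.
  rewrite hintZ ?mul0r//; apply: bounded_borelZ.
  exact: harmonic_bounded_borel.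
- move=> P Q [g [Hg cg]] [k [Hk ck]]; exists (fun n y => g n y + k n y); split.
    apply: filterS2 Hg Hk => n [bg Hg] [bk Hk]; split.
      exact: bounded_borelD.
    move=> y By; have [g0 g1] := Hg y By; have [k0 k1] := Hk y By.
    split; first exact: addr_ge0.
    move=> nPQ; have [Py|/g1 g1'] := pselect (P (n, y)); last first.
      by rewrite ler_wpDr.
    by rewrite ler_wpDl// k1// => Qy; apply: nPQ.
  have Hgk : hint omega (Dn n) x0 (fun y => g n y * h y) +
      hint omega (Dn n) x0 (fun y => k n y * h y) @[n --> \oo] --> (0 : R).
    by rewrite -[X in _ --> X]addr0; exact: cvgD.
  apply: (cvg_near_eq Hgk).
  apply: filterS2 Hg Hk => n [bg _] [bk _] /=.
  have bh : bounded_borel (boundary (Dn n)) h by exact: harmonic_bounded_borel.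
  rewrite -hintD; [|exact: bounded_borelM|exact: bounded_borelM].
  by apply: hint_eq => y _; rewrite mulrDl.
- move=> P Q PQ [g [Hg cg]]; exists g; split => //.
  apply: filterS Hg => n [bg Hg]; split => // y By.
  have [g0 g1] := Hg y By; split => // nQ; apply: g1 => Py.
  by apply: nQ; exact: PQ.
Qed.

(** At each [x], the distance [`|K n x y - h x|] divided by the tolerance is a
    majorant of the exceptional set, and its mass tends to zero by
    [kernel_mean_dist]; equicontinuity extends the estimate to a neighbourhood
    of [x], and compactness does the rest. *)
Lemma kernel_near_uniformly C (e : R) : compact C -> C `<=` D -> 0 < e ->
  mass_filter [set p | C `<=` [set x | `|K p.1 x p.2 - h x| <= e]].
Proof.
move=> cC CD e0; have [[[ch _] h0 hx0] _] := h_extreme.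
have FF := mass_filter_filter.
apply: ((compact_near_coveringP _).1 cC _ mass_filter
  (fun p x => `|K p.1 x p.2 - h x| <= e)) => x Cx.
have Dx := CD _ Cx.
have e3 : 0 < e / 3 by rewrite divr_gt0.
have [m Hm] := exhaustion_oscillation Dx e3.
have /subspace_continuousP/(_ _ Dx)/cvgrPdist_le/(_ _ e3) := ch.
rewrite near_withinE => Hh.
exists ([set x' | `|h x - h x'| <= e / 3 /\ forall n y, (m < n)%N ->
      boundary (Dn n) y -> `|K n x y - K n x' y| <= e / 3],
   [set p | [/\ (m < p.1)%N, boundary (Dn p.1) p.2 &
      `|K p.1 x p.2 - h x| <= e / 3]]) => [|[x' [n y]] /=].
  split => /=.
    apply: filterS2 Hm Hh => x' [Dx' H] H'; split.
      by apply: H'; exact: exhaustion_subD Dx'.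
    by move=> n y mn By; have [_] := H n mn; apply.
  exists (fun n y => (e / 3)^-1 * `|K n x y - h x|); split.
    have near_m : \forall n \near \oo, (m < n)%N by exact: nbhs_infty_gt.
    apply: filterS2 near_m (near_exhaustion_pt Dx) => n mn Dnx; split.
      apply: bounded_borelZ; apply: bounded_borel_norm.
      apply: bounded_borelB; last exact: bounded_borel_cst.
      exact: kernel_bounded_borel.
    move=> y By; split; first by rewrite mulr_ge0// invr_ge0 ltW.
    move=> /= nE; rewrite mulrC ler_pdivlMr// mul1r leNgt; apply/negP => H.
    by apply: nE; split => //; exact: ltW.
  apply: (cvg_near_eq (cvg0Z (e / 3)^-1 (kernel_mean_dist Dx))).
  apply: filterS (near_exhaustion_pt Dx) => n Dnx /=.
  rewrite -hintZ; first by apply: hint_eq => y _; rewrite mulrA.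
  apply: bounded_borelM; last exact: harmonic_bounded_borel.
  apply: bounded_borel_norm.
  apply: bounded_borelB; last exact: bounded_borel_cst.
  exact: kernel_bounded_borel.
move=> [[H1 H2] [mn By H3]]; have H4 := H2 n y mn By.
move: H1 H3 H4; rewrite !ler_norml => /andP[? ?] /andP[? ?] /andP[? ?].
by apply/andP; split; lra.
Qed.

(** If no boundary point of [O] were good, the majorant of the exceptional set
    would have at least the mass [c] of [O]. *)
Lemma kernel_near_in O C (c e : R) : open O -> 0 < c ->
  (\forall n \near \oo, c <= hint omega (Dn n) x0 (fun y => \1_O y * h y)) ->
  compact C -> C `<=` D -> 0 < e ->
  \forall n \near \oo, exists y, [/\ boundary (Dn n) y, O y &
    forall x, C x -> `|K n x y - h x| <= e].
Proof.
move=> oO c0 Hc cC CD e0; have [[[ch _] h0 hx0] _] := h_extreme.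
have [g [Hg cg]] := kernel_near_uniformly cC CD e0.
have /cvgrPdist_lt/(_ _ c0) Hgc := cg.
apply: filterS3 Hc Hg Hgc => n cn [bg Hg]; rewrite sub0r normrN => gc.
apply: contrapT => nE.
have bh : bounded_borel (boundary (Dn n)) h by exact: harmonic_bounded_borel.
suff H : hint omega (Dn n) x0 (fun y => \1_O y * h y) <=
    hint omega (Dn n) x0 (fun y => g n y * h y).
  have := le_lt_trans (le_trans cn H) (le_lt_trans (ler_norm _) gc).
  by rewrite ltxx.
apply: hint_le.
- by apply: bounded_borelM => //; apply: bounded_borel_indic; exact: open_borel.
- exact: bounded_borelM.
- move=> y By; have /h0/ltW hy := exhaustion_boundary_sub By.
  have [gy0 gy1] := Hg y By.
  rewrite ler_wpM2r// indicE; have [Oy|//] := boolP (y \in O).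
  apply: gy1 => H; apply: nE; exists y; split => //.
  by move: Oy; rewrite inE.
Qed.

End Exhaustion.

(** * Choice of the boundary points *)

(** At stage [n], take a point satisfying the strongest condition [Q k n] with
    [k <= n] that can be satisfied. *)
Lemma diagonal_choice (T : pointedType) (Q : nat -> nat -> T -> Prop) :
  (forall k n y, Q k.+1 n y -> Q k n y) ->
  (forall k, \forall n \near \oo, exists y, Q k n y) ->
  exists t : nat -> T, forall k, \forall n \near \oo, Q k n (t n).
Proof.
move=> Qdecr Qex.
have Qle k l n y : (k <= l)%N -> Q l n y -> Q k n y.
  by move=> /subnK <-; elim: (l - k)%N => // d IH /Qdecr.
have best n l : exists y, forall k, (k <= l)%N ->
    (exists y', Q k n y') -> Q k n y.
  elim: l => [|l [y IH]].
    have [[y Qy]|nQ] := pselect (exists y, Q 0%N n y).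
      by exists y => k; rewrite leqn0 => /eqP ->.
    by exists point => k; rewrite leqn0 => /eqP ->.
  have [[y' Qy']|nQ] := pselect (exists y', Q l.+1 n y').
    by exists y' => k kl _; exact: Qle Qy'.
  exists y => k; rewrite leq_eqVlt => /predU1P[->//|]; exact: IH.
have [t Ht] := choice (fun n => best n n).
exists t => k; apply: filterS2 (nbhs_infty_ge k) (Qex k) => n kn.
exact: Ht.
Qed.

Lemma limn_einf_gt0 (R : realType) (u : (\bar R)^nat) :
  (0 < limn_einf u)%E ->
  exists2 c : R, 0 < c & \forall n \near \oo, (c%:E <= u n)%E.
Proof.
rewrite limn_einf_lim; have -> := cvg_lim _ (@cvg_einfs_sup R u); last exact.
move=> /ereal_sup_gt[_ [N _ <-] u0].
have [c c0 cu] : exists2 c : R, 0 < c & (c%:E <= einfs u N)%E.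
  move: u0; case: (einfs u N) => [r| |//]; first by rewrite lte_fin; exists r.
  by exists 1 => //; rewrite leey.
exists c => //; exists N => // n Nn; apply: le_trans cu _.
by apply: ereal_inf_lbound; exists n.
Qed.

Lemma boundary_mass_hint (R : realType) (X : pmetricType R)
    (omega : set X -> X -> probability (borel X) R) (U O : set X) x0 h
    (Y : Type) (i : X -> Y) (V : set Y) :
  open O -> boundary U `&` i @^-1` V = boundary U `&` O ->
  bounded_borel (boundary U) h ->
  boundary_mass omega U x0 h i V =
  (hint omega U x0 (fun y => \1_O y * h y))%:E.
Proof.
move=> oO VO bh; rewrite /boundary_mass VO integral_mkcondr /hint /Rintegral.
have bb : bounded_borel (boundary U) (fun y => \1_O y * h y).
  by apply: bounded_borelM => //; apply: bounded_borel_indic; exact: open_borel.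
rewrite fineK; last first.
  apply: integrable_fin_num; first exact: measurable_boundary.
  by apply: bounded_borel_integrable => //; exact: measurable_boundary.
apply: eq_integral => y _; rewrite patchE indicE.
by case: (y \in O); rewrite ?mul1r ?mul0r.
Qed.

Lemma cvg_uniform_dist (R : realType) (X : choiceType) (C : set X)
    (f : nat -> X -> R) (g : X -> R) :
  (forall e, 0 < e ->
    \forall n \near \oo, forall x, C x -> `|f n x - g x| <= e) ->
  {uniform C, f @ \oo --> g}.
Proof.
move=> H P /uniform_nbhs[E [/= entE EP]].
have [e e0 eE] : exists2 e : R, 0 < e &
    [set xy : R * R | ball xy.1 e xy.2] `<=` E.
  by move: entE; rewrite -entourage_from_ballE => -[e e0 eE]; exists e.
have e2 : 0 < e / 2 by rewrite divr_gt0.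
apply: filterS (H _ e2) => n Hn; apply: EP => x Cx; apply: eE => /=.
rewrite -ball_normE /= distrC (le_lt_trans (Hn x Cx))//.
by rewrite ltr_pdivrMr// ltr_pMr// ltr1n.
Qed.

Theorem theorem4p3 (R : realType) (X : pmetricType R)
    (dom : set (set X)) (omega : set X -> X -> probability (borel X) R)
    (D : set X) (x0 : X) (Dn : nat -> set X) (K : nat -> X -> X -> R)
    (Y : metricType R) (i : X -> Y) (xi : Y) (h : X -> R)
    (fw : framework omega dom)
    (domD : domain D) (Dx0 : D x0)
    (Dn_dom : forall n, dom (Dn n))
    (Dn_regular : forall n, regular omega (Dn n))
    (Dn0_x0 : Dn 0%N x0)
    (Dn_incr : forall n, compactly_contained (Dn n) (Dn n.+1))
    (D_union : D = \bigcup_n Dn n)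
    (K_version : forall n, kernel_version omega (Dn n) x0 (K n))
    (K_continuous : forall n, jointly_continuous (Dn n) (K n))
    (compactY : compactification D i)
    (xi_boundary : ~ (i @` D) xi)
    (h_extreme : extreme_harmonic omega dom D x0 h)
    (mass_pos : forall V : set Y, open V -> V xi ->
      (0 < limn_einf (fun n => boundary_mass omega (Dn n) x0 h i V))%E) :
  exists (n0 : nat) (xin : nat -> X),
    [/\ forall n, (n0 <= n)%N -> boundary (Dn n) (xin n),
        i (xin n) @[n --> \oo] --> xi,
        forall C : set X, compact C -> C `<=` D ->
          {uniform C, (fun n x => K n x (xin n)) @ \oo --> h}
      & (forall n y, boundary (Dn n) y ->
           minimal omega dom (Dn n) (fun x => K n x y)) ->
        forall n, (n0 <= n)%N ->
          minimal_boundary omega dom (Dn n) (K n) (xin n) /\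
          minimal_boundary omega dom (Dn n) (K n) = boundary (Dn n)].
Proof.
pose eps k : R := k.+1%:R^-1.
have eps0 k : 0 < eps k by rewrite invr_gt0.
have epsS k : eps k.+1 <= eps k by rewrite lef_pV2 ?posrE// ler_nat.
pose Q k n y := [/\ boundary (Dn n) y, ball xi (eps k) (i y) &
  forall x, closure (Dn k) x -> `|K n x y - h x| <= eps k].
have Qdecr k n y : Q k.+1 n y -> Q k n y.
  move=> [By xiy H]; split => //; first exact: le_ball xiy.
  move=> x kx; apply: le_trans (epsS k); apply: H.
  apply: closureS kx; apply: subset_trans (Dn_incr k).2.
  exact: subset_closure.
have Qex k : \forall n \near \oo, exists y, Q k n y.
  pose V := (ball xi (eps k))°.
  have oV : open V by exact: open_interior.
  have Vxi : V xi by exact: nbhsx_ballx.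
  (* As [i] is a homeomorphism onto its image, the part of the boundary that it
     maps into [V] is cut out by an open set of [X], independent of [n]. *)
  have [ O oO VO] : exists2 O, open O & D `&` i @^-1` V = D `&` O.
    by case: compactY => _ _ _ H _; apply/(H _ (@subIsetl _ _ _)); exists V.
  have BD n : boundary (Dn n) `<=` D.
    exact: exhaustion_boundary_sub Dn_incr D_union n.
  have BVO n : boundary (Dn n) `&` i @^-1` V = boundary (Dn n) `&` O.
    by rewrite -(setIidl (BD n)) -!setIA VO.
  have [c c0 Hc] := limn_einf_gt0 (mass_pos V oV Vxi).
  have [cD DnD] := exhaustion_compactly_containedD Dn_incr D_union k.
  have mass n : boundary_mass omega (Dn n) x0 h i V =
      (hint omega (Dn n) x0 (fun y => \1_O y * h y))%:E.
    apply: boundary_mass_hint => //.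
    case: h_extreme => -[[ch _] _ _] _.
    exact: (harmonic_bounded_borel Dn_incr D_union n ch).
  have Hc' : \forall n \near \oo,
      c <= hint omega (Dn n) x0 (fun y => \1_O y * h y).
    by apply: filterS Hc => n; rewrite mass lee_fin.
  have := kernel_near_in fw Dn_dom Dn_regular Dn0_x0 Dn_incr D_union K_version
    K_continuous h_extreme oO c0 Hc' cD DnD (eps0 k).
  apply: filterS => n [y [By Oy Hy]]; exists y; split => //.
  apply: interior_subset.
  by have [] : (boundary (Dn n) `&` i @^-1` V) y by rewrite BVO.
have [xin Hxin] := diagonal_choice Qdecr Qex.
have [n0 _ Hn0] := Hxin 0%N.
exists n0, xin; split.
- by move=> n /Hn0[].
- apply/cvg_ballP => e e0.
  have [k _ /(_ k (leqnn k)) ke] := near_infty_natSinv_lt (PosNum e0).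
  apply: filterS (Hxin k) => n [_ H _]; apply: le_ball H.
  exact: ltW ke.
- move=> C cC CD; apply: cvg_uniform_dist => e e0.
  have nD := near_exhaustion fw Dn_dom Dn_incr D_union cC CD.
  have nk := near_infty_natSinv_lt (PosNum e0).
  have [k [CDk ke]] := filter_ex (filterI nD nk).
  apply: filterS (Hxin k) => n [_ _ H] x Cx; apply: le_trans (ltW ke).
  by apply: H; exact/subset_closure/CDk.
- move=> Kmin n /Hn0[Bn _ _]; split; first by split => //; exact: Kmin.
  by apply/seteqP; split=> [y []//|y By]; split => //; exact: Kmin.
Qed.
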